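(* There is a finitely generated group of computable permutations of $\omega$ whose word problem is a $\Pi^0_1$-universal equivalence relation.
   Context: For a group $G$ generated by finitely many permutations $g_1,\dots,g_k$ of $\omega$, the word problem is the equivalence relation on the free group $F(g_1,\dots,g_k)$ (words in the generators, coded by natural numbers) relating two words iff they evaluate to the same permutation. For equivalence relations $R,S$ on $\omega$, $R$ is computably reducible to $S$ ($R\le S$) if there is a computable $f$ with $x\,R\,y \Leftrightarrow f(x)\,S\,f(y)$ for all $x,y$. An equivalence relation is $\Pi^0_1$-universal if it is $\Pi^0_1$ and every $\Pi^0_1$ equivalence relation on $\omega$ is computably reducible to it. *)

(* Defs.v *)
From Stdlib Require Export RelationClasses.
From mathcomp Require Export all_boot.

Set Implicit Arguments.
Unset Strict Implicit.
Unset Printing Implicit Defensive.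

(** * Partial recursive functions *)

(* Kleene's schemes. Arguments are passed as a list instead of a vector of
   fixed arity: missing arguments are read as 0 and superfluous ones are
   ignored, which does not change the class of functions computed. *)
Inductive recf : Type :=
  | Zero
  | Succ
  | Proj (i : nat)
  | Comp (f : recf) (gs : seq recf)
  | Prec (f g : recf)
  | Mu (f : recf).

(* [reval c v y]: on the arguments [v], [c] converges with value [y].
   - [Prec f g] is primitive recursion on the first argument:
       h (0, w) = f w  and  h (i + 1, w) = g (i, h (i, w), w);
     [s] is the sequence of the intermediate values h (i, w).
   - [Mu f] searches for the least [y] with f (y, v) = 0; all the values
     f (z, v), z < y, must be defined. *)
Fixpoint reval (c : recf) (v : seq nat) (y : nat) {struct c} : Prop :=
  match c with
  | Zero => y = 0
  | Succ => y = (nth 0 v 0).+1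
  | Proj i => y = nth 0 v i
  | Comp f gs =>
      exists2 ys : seq nat,
        (fix revals (gs : seq recf) (ys : seq nat) {struct gs} : Prop :=
           match gs, ys with
           | [::], [::] => True
           | g :: gs', z :: ys' => reval g v z /\ revals gs' ys'
           | _, _ => False
           end) gs ys
        & reval f ys y
  | Prec f g =>
      exists s : nat -> nat,
        [/\ reval f (behead v) (s 0),
            forall i, i < head 0 v ->
              reval g [:: i, s i & behead v] (s i.+1)
          & y = s (head 0 v)]
  | Mu f =>
      reval f (y :: v) 0 /\
      forall z, z < y -> exists k, reval f (z :: v) k.+1
  end.

Lemma recf_nested_ind (P : recf -> Prop) :
    P Zero -> P Succ -> (forall i, P (Proj i)) ->
    (forall f gs, P f -> (forall i, i < size gs -> P (nth Zero gs i)) ->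
       P (Comp f gs)) ->
    (forall f g, P f -> P g -> P (Prec f g)) ->
    (forall f, P f -> P (Mu f)) ->
  forall c, P c.
Proof.
move=> h0 h1 h2 h3 h4 h5.
fix IH 1 => -[||i|f gs|f g|f]; [exact: h0|exact: h1|exact: h2| | |].
- apply: h3; first exact: IH.
  move=> i _; move: i; move: gs.
  by fix IHs 1 => -[|g gs] [|i] /=; [exact: h0|exact: h0|exact: IH|exact: IHs].
- by apply: h4; exact: IH.
- by apply: h5; exact: IH.
Qed.

Lemma reval_det (c : recf) (v : seq nat) (y z : nat) :
  reval c v y -> reval c v z -> y = z.
Proof.
elim/recf_nested_ind: c v y z => [||i|f gs If Ig|f g If Ig|f If] v y z /=; try by move=> -> ->.
- move=> [ys A B] [zs C D]. suff E : ys = zs by rewrite E in B; exact: If B D.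
  elim: gs Ig ys zs A C {B D} => [|g gs IH] Ig [|a ys] [|b zs] //= [A1 A2] [C1 C2].
  rewrite (Ig 0 isT _ _ _ A1 C1) (IH _ ys zs A2 C2) // => i. exact: (Ig i.+1).
- move=> [s [A B ->]] [t [C D ->]].
  suff: forall i, i <= head 0 v -> s i = t i by apply.
  elim=> [_|i IH Hi]; first exact: If A C.
  have := D i Hi. rewrite -IH; last exact: ltnW. exact: Ig (B i Hi).
- move=> [A B] [C D]. case: (ltngtP y z) => // H.
  + by have [k /(If _ _ _ A)] := D _ H.
  + by have [k /(If _ _ _ C)] := B _ H.
Qed.

Definition computable (f : nat -> nat) : Prop :=
  exists c : recf, forall x, reval c [:: x] (f x).

(* Via the characteristic function, with [true] and [false] as 1 and 0. *)
Definition computable_rel3 (T : nat -> nat -> nat -> bool) : Prop :=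
  exists c : recf, forall x y z, reval c [:: x; y; z] (nat_of_bool (T x y z)).

(** * Equivalence relations on the natural numbers *)

Definition Pi01 (R : nat -> nat -> Prop) : Prop :=
  exists2 T : nat -> nat -> nat -> bool,
    computable_rel3 T & forall x y, R x y <-> forall n, T x y n.

Definition comp_reducible (R S : nat -> nat -> Prop) : Prop :=
  exists2 f : nat -> nat,
    computable f & forall x y, R x y <-> S (f x) (f y).

Definition Pi01_universal (S : nat -> nat -> Prop) : Prop :=
  [/\ Equivalence S,
      Pi01 S
    & forall R : nat -> nat -> Prop,
        Equivalence R -> Pi01 R -> comp_reducible R S].

(** * Finitely generated permutation groups *)

Record permN : Type := PermN {
  pfun :> nat -> nat;
  pinv : nat -> nat;
  pfunK : cancel pfun pinv;
  pinvK : cancel pinv pfun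
}.

Definition perm_one : permN := @PermN id id (frefl id) (frefl id).

Definition perm_mul (p q : permN) : permN :=
  PermN (can_comp (pfunK p) (pfunK q)) (can_comp (pinvK q) (pinvK p)).

Definition perm_inv (p : permN) : permN := PermN (pinvK p) (pfunK p).

(* Words over k generators and their inverses; the letter (i, b) stands for
   g_i if b = false and for g_i^-1 if b = true. A word need not be reduced:
   it denotes an element of the free group. *)
Definition word (k : nat) : Type := seq ('I_k * bool).

Definition letter_eval k (g : 'I_k -> permN) (a : 'I_k * bool) : permN :=
  if a.2 then perm_inv (g a.1) else g a.1.

Definition word_eval k (g : 'I_k -> permN) (w : word k) : permN :=
  foldr (fun a p => perm_mul (letter_eval g a) p) perm_one w.

Definition generated k (g : 'I_k -> permN) (p : permN) : Prop :=
  exists w : word k, p =1 word_eval g w.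

(* Bijective numeration in base 2k; see [word_code_inj], [word_code_surj]. *)
Definition letter_code k (a : 'I_k * bool) : nat := a.1.*2 + a.2.

Definition word_code k (w : word k) : nat :=
  foldr (fun a n => (n * k.*2 + letter_code a).+1) 0 w.

Definition word_problem k (g : 'I_k -> permN) (x y : nat) : Prop :=
  exists u v : word k,
    [/\ word_code u = x, word_code v = y & word_eval g u =1 word_eval g v].

Lemma letter_code_lt k (a : 'I_k * bool) : letter_code a < k.*2.
Proof.
case: a => i b; rewrite /letter_code /= -(ltn_half_double) //.
by rewrite addnC half_bit_double.
Qed.

Lemma letter_code_inj k : injective (@letter_code k).
Proof.
move=> [i b] [j c]; rewrite /letter_code /= => E.
have Eb : b = c by move/(congr1 odd): E; rewrite !oddD !odd_double !oddb.
have Ei : i = j.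
  apply: val_inj; move/(congr1 half): E.
  by rewrite ![_.*2 + _]addnC !half_bit_double.
by rewrite Eb Ei.
Qed.

Lemma word_code_inj k : injective (@word_code k).
Proof.
elim=> [|a u IH] [|b v] //= [] E.
have k_gt0 : 0 < k.*2 by apply: leq_ltn_trans (letter_code_lt a).
have Ea : a = b.
  apply: letter_code_inj; move/(congr1 (modn^~ k.*2)): E.
  by rewrite !modnMDl !modn_small ?letter_code_lt.
have Eu : u = v.
  apply: IH; move/(congr1 (divn^~ k.*2)): E.
  by rewrite !divnMDl // !divn_small ?letter_code_lt // !addn0.
by rewrite Ea Eu.
Qed.

Lemma word_code_surj k (n : nat) : 0 < k -> exists w : word k, word_code w = n.
Proof.
move=> k_gt0; elim/ltn_ind: n => -[|n] IH; first by exists [::].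
have [|w Ew] := IH (n %/ k.*2); first by rewrite ltnS leq_div.
have lt_r : (n %% k.*2)./2 < k.
  by rewrite ltn_half_double ltn_pmod // double_gt0.
exists ((Ordinal lt_r, odd (n %% k.*2)) :: w).
rewrite /= Ew /letter_code /= [_.*2 + _]addnC odd_double_half.
by rewrite -divn_eq.
Qed.

(* Main.v *)
(** A [Pi01] equivalence relation R has decidable approximations R_s decreasing to R,
    and for every n some stage s(n) at which R_s is an equivalence relation on [0 .. n].
    Sending x <= n to the least element of its R_s(n)-class, and x > n first to the
    least element of its R_s(x)-class, and so on, gives a computable function of (n, x)
    that depends only on the R-class of x and separates the classes as n grows. So
    x R y iff the decidable sets G_x and G_y coincide, for some computable G.

    Partial programs cannot be run inside a total permutation, but whether a program
    halts after exactly t steps is decidable. Let e be a program that on input i lists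
    the answers "i in G_x" for all x <= i; its running time t(i) does not depend on x.
    The set of pairs (i, t(i)) with i in G_x is then decidable uniformly in e, in x, and
    in a finite table for the i < x, which the reduction can compute. This gives one
    uniformly decidable family (A_m) such that every [Pi01] equivalence relation reduces
    to equality of its members.

    Finally let permutations act on columns, the points of column c being pairs (j, f).
    Two involutions of the columns generate a shift h, a third involution g exchanges the
    points (j, 0) and (j, 1) of column 2m for j in A_m, and a fourth one, q, exchanges
    (j, 1) and (j, 2) in column 0 only. Conjugating q by h^-m g h^m gives a permutation
    supported on column 0 from which A_m can be read off, and determined by A_m. *)

Require Import Defs.
From Stdlib Require Cantor.
From Stdlib Require Import Classical_Prop.
From mathcomp Require Import zify.

Set Implicit Arguments.
Unset Strict Implicit.
Unset Printing Implicit Defensive.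

(** * Computable functions between encoded types *)

Definition pr (a b : nat) : nat := Cantor.to_nat (a, b).
Definition p1 (n : nat) : nat := (Cantor.of_nat n).1.
Definition p2 (n : nat) : nat := (Cantor.of_nat n).2.

Lemma p1K a b : p1 (pr a b) = a.
Proof. by rewrite /p1 /pr Cantor.cancel_of_to. Qed.

Lemma p2K a b : p2 (pr a b) = b.
Proof. by rewrite /p2 /pr Cantor.cancel_of_to. Qed.

Lemma prK n : pr (p1 n) (p2 n) = n.
Proof. by rewrite /p1 /p2 /pr -surjective_pairing Cantor.cancel_to_of. Qed.

Definition triangle (n : nat) : nat := \sum_(i < n) i.+1.

Lemma triangleS n : triangle n.+1 = triangle n + n.+1.
Proof. by rewrite /triangle big_ord_recr. Qed.

Lemma triangle0 : triangle 0 = 0.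
Proof. by rewrite /triangle big_ord0. Qed.

Lemma prE a b : pr a b = b + triangle (a + b).
Proof.
rewrite /pr /= !plusE [a + b]addnC; congr addn.
by elim: (b + a) => [|n IH]; rewrite ?triangle0 ?triangleS //= IH; lia.
Qed.

Lemma leq_triangle m n : m <= n -> triangle m <= triangle n.
Proof.
by move=> /subnKC <-; elim: (n - m) => [|k]; rewrite ?addn0 // addnS triangleS; lia.
Qed.

(** Functions of the whole argument list, as in Kleene's schemes. Pairing is built at this level;
    afterwards functions take one encoded argument. *)
Definition rec_fun (F : seq nat -> nat) : Prop :=
  exists c, forall v, reval c v (F v).

Lemma rec_fun_ext F G : F =1 G -> rec_fun F -> rec_fun G.
Proof. by move=> E [c Hc]; exists c => v; rewrite -E. Qed.

Lemma rec_fun_zero : rec_fun (fun=> 0).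
Proof. by exists Zero. Qed.

Lemma rec_fun_nth i : rec_fun (nth 0 ^~ i).
Proof. by exists (Proj i). Qed.

Lemma rec_fun_comp1 F G1 :
  rec_fun F -> rec_fun G1 -> rec_fun (fun v => F [:: G1 v]).
Proof.
by move=> [f Hf] [g1 H1]; exists (Comp f [:: g1]) => v /=; exists [:: G1 v].
Qed.

Lemma rec_fun_comp2 F G1 G2 :
  rec_fun F -> rec_fun G1 -> rec_fun G2 -> rec_fun (fun v => F [:: G1 v; G2 v]).
Proof.
move=> [f Hf] [g1 H1] [g2 H2]; exists (Comp f [:: g1; g2]) => v /=.
by exists [:: G1 v; G2 v].
Qed.

Lemma rec_fun_succ G : rec_fun G -> rec_fun (fun v => (G v).+1).
Proof. by apply: (@rec_fun_comp1 (fun v => (nth 0 v 0).+1)); exists Succ. Qed.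

Lemma rec_fun_prec F G :
  rec_fun F -> rec_fun G ->
  rec_fun (fun v => nat_rect (fun=> nat) (F (behead v))
                      (fun i h => G [:: i, h & behead v]) (head 0 v)).
Proof.
move=> [f Hf] [g Hg]; exists (Prec f g) => v /=.
by exists (nat_rect (fun=> nat) (F (behead v)) (fun i h => G [:: i, h & behead v])).
Qed.

Lemma rec_fun_mu F (ex : forall v, exists n, F (n :: v) == 0) :
  rec_fun F -> rec_fun (fun v => ex_minn (ex v)).
Proof.
move=> [f Hf]; exists (Mu f) => v /=; case: ex_minnP => m /eqP Fm min; split.
  by rewrite -Fm.
move=> z lt_zm; exists (F (z :: v)).-1.
have := Hf (z :: v); case E: (F (z :: v)) => [|k] //.
by have := min z; rewrite E leqNgt lt_zm => /(_ isT).
Qed.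

Lemma rec_fun_add F G : rec_fun F -> rec_fun G -> rec_fun (fun v => F v + G v).
Proof.
move=> HF HG.
have := rec_fun_prec (rec_fun_nth 0) (rec_fun_succ (rec_fun_nth 1)).
move=> /rec_fun_comp2 /(_ HF HG); apply: rec_fun_ext => v /=.
by elim: (F v) => //= n ->.
Qed.

Lemma rec_fun_pred G : rec_fun G -> rec_fun (fun v => (G v).-1).
Proof.
move=> HG; have := rec_fun_prec rec_fun_zero (rec_fun_nth 0).
by move=> /rec_fun_comp1 /(_ HG); apply: rec_fun_ext => v /=; case: (G v).
Qed.

Lemma rec_fun_sub F G : rec_fun F -> rec_fun G -> rec_fun (fun v => F v - G v).
Proof.
move=> HF HG.
have := rec_fun_prec (rec_fun_nth 0) (rec_fun_pred (rec_fun_nth 1)).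
move=> /rec_fun_comp2 /(_ HG HF); apply: rec_fun_ext => v /=.
by elim: (G v) => [|n /= ->]; rewrite ?subn0 // subnS.
Qed.

Lemma rec_fun_triangle G : rec_fun G -> rec_fun (fun v => triangle (G v)).
Proof.
move=> HG.
have := rec_fun_prec rec_fun_zero
  (rec_fun_add (rec_fun_nth 1) (rec_fun_succ (rec_fun_nth 0))).
move=> /rec_fun_comp1 /(_ HG); apply: rec_fun_ext => v /=.
by elim: (G v) => [|n /= ->]; rewrite ?triangle0 ?triangleS.
Qed.

Lemma rec_fun_pr F G : rec_fun F -> rec_fun G -> rec_fun (fun v => pr (F v) (G v)).
Proof.
move=> HF HG; have := rec_fun_add HG (rec_fun_triangle (rec_fun_add HF HG)).
by apply: rec_fun_ext => v; rewrite prE.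
Qed.

(** The antidiagonal of [n] is the least [d] with [n < triangle d.+1], which [Mu] finds; both
    projections then follow by subtraction. *)
Lemma rec_fun_diagonal G : rec_fun G -> rec_fun (fun v => p1 (G v) + p2 (G v)).
Proof.
move=> HG; set F := fun v => (nth 0 v 1).+1 - triangle (nth 0 v 0).+1.
have HF : rec_fun F.
  apply: rec_fun_sub; first exact: rec_fun_succ (rec_fun_nth 1).
  by apply: rec_fun_triangle; apply: rec_fun_succ (rec_fun_nth 0).
have ex v : exists n, F (n :: v) == 0.
  exists (nth 0 v 0); rewrite /F /= triangleS; apply/eqP; lia.
have := rec_fun_comp1 (rec_fun_mu ex HF) HG; apply: rec_fun_ext => v.
case: ex_minnP => d; rewrite /F /= => Hd min.
have E := prE (p1 (G v)) (p2 (G v)); rewrite prK in E.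
apply/eqP; rewrite eqn_leq; apply/andP; split.
  by apply: min; rewrite triangleS; apply/eqP; lia.
rewrite leqNgt; apply/negP => lt_d; have := leq_triangle lt_d; lia.
Qed.

Lemma rec_fun_p2 G : rec_fun G -> rec_fun (fun v => p2 (G v)).
Proof.
move=> HG; have := rec_fun_sub HG (rec_fun_triangle (rec_fun_diagonal HG)).
by apply: rec_fun_ext => v; have := prE (p1 (G v)) (p2 (G v)); rewrite prK; lia.
Qed.

Lemma rec_fun_p1 G : rec_fun G -> rec_fun (fun v => p1 (G v)).
Proof.
move=> HG; have := rec_fun_sub (rec_fun_diagonal HG) (rec_fun_p2 HG).
by apply: rec_fun_ext => v; lia.
Qed.

(** * Computability on types encoded by numbers *)

Class encoding (A : Type) := encode : A -> nat.
#[global] Instance encoding_nat : encoding nat := id.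
#[global] Instance encoding_bool : encoding bool := nat_of_bool.
#[global] Instance encoding_prod A B `{encoding A} `{encoding B} : encoding (A * B) :=
  fun p => pr (encode p.1) (encode p.2).

(** On [nat] the encoding is the identity, so there this is [computable]. *)
Definition cfun {A B : Type} `{encoding A} `{encoding B} (f : A -> B) : Prop :=
  exists c, forall a, reval c [:: encode a] (encode (f a)).

Section Closure.
Context {E A B : Type} `{encoding E} `{encoding A} `{encoding B}.

Lemma cfun_ext (f g : E -> A) : f =1 g -> cfun f -> cfun g.
Proof. by move=> Efg [c Hc]; exists c => e; rewrite -Efg. Qed.

Lemma cfun_id : cfun (fun e : E => e).
Proof. by exists (Proj 0). Qed.

Lemma cfun_comp (g : A -> B) (f : E -> A) :
  cfun g -> cfun f -> cfun (fun e => g (f e)).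
Proof.
by move=> [d Hd] [c Hc]; exists (Comp d [:: c]) => e /=; exists [:: encode (f e)].
Qed.

Lemma cfun_op1 (op : A -> B) (f : E -> A) F :
  rec_fun F -> (forall a, F [:: encode a] = encode (op a)) ->
  cfun f -> cfun (fun e => op (f e)).
Proof. by move=> [d Hd] EF; apply: cfun_comp; exists d => a; rewrite -EF. Qed.

Lemma cfun_op2 C `{encoding C} (op : A -> B -> C) (f : E -> A) (g : E -> B) F :
  rec_fun F -> (forall a b, F [:: encode a; encode b] = encode (op a b)) ->
  cfun f -> cfun g -> cfun (fun e => op (f e) (g e)).
Proof.
move=> [d Hd] EF [a Ha] [b Hb]; exists (Comp d [:: a; b]) => e /=.
by exists [:: encode (f e); encode (g e)]; rewrite // -EF.
Qed.

End Closure.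

Section Products.
Context {E A B : Type} `{encoding E} `{encoding A} `{encoding B}.

Lemma cfun_pair (f : E -> A) (g : E -> B) :
  cfun f -> cfun g -> cfun (fun e => (f e, g e)).
Proof.
by apply: (cfun_op2 (op := pair));
  first exact: rec_fun_pr (rec_fun_nth 0) (rec_fun_nth 1).
Qed.

Lemma cfun_fst (f : E -> A * B) : cfun f -> cfun (fun e => (f e).1).
Proof.
apply: (cfun_op1 (op := fst)); first exact: rec_fun_p1 (rec_fun_nth 0).
by move=> a /=; rewrite p1K.
Qed.

Lemma cfun_snd (f : E -> A * B) : cfun f -> cfun (fun e => (f e).2).
Proof.
apply: (cfun_op1 (op := snd)); first exact: rec_fun_p2 (rec_fun_nth 0).
by move=> a /=; rewrite p2K.
Qed.

Lemma cfun_const (a : A) : cfun (fun _ : E => a).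
Proof.
rewrite /cfun; elim: (encode a) => [|n [c Hc]]; first by exists Zero.
by exists (Comp Succ [:: c]) => e /=; exists [:: n].
Qed.

Lemma cfun_natrec (x : E -> A) (f : E -> nat -> A -> A) (n : E -> nat) :
  cfun x -> cfun (fun p : E * (nat * A) => f p.1 p.2.1 p.2.2) -> cfun n ->
  cfun (fun e => nat_rect (fun=> A) (x e) (f e) (n e)).
Proof.
move=> [cx Hx] [cf Hf] [cn Hn].
have [pair Hpair] := rec_fun_pr (rec_fun_nth 2)
  (rec_fun_pr (rec_fun_nth 0) (rec_fun_nth 1)).
exists (Comp (Prec cx (Comp cf [:: pair])) [:: cn; Proj 0]) => e.
exists [:: n e; encode e] => //=.
exists (fun i => encode (nat_rect (fun=> A) (x e) (f e) i)); split=> //= i _.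
by eexists [:: _]; [split; [exact: Hpair|] | exact: (Hf (e, (i, _)))].
Qed.

End Products.

Section Arithmetic.
Context {E : Type} `{encoding E}.
Implicit Types (f g : E -> nat) (b c : E -> bool).

Lemma cfun_pr f g : cfun f -> cfun g -> cfun (fun e => pr (f e) (g e)).
Proof.
by apply: (cfun_op2 (op := pr));
  first exact: rec_fun_pr (rec_fun_nth 0) (rec_fun_nth 1).
Qed.

Lemma cfun_p1 f : cfun f -> cfun (fun e => p1 (f e)).
Proof.
by apply: (cfun_op1 (op := p1));
  first exact: rec_fun_p1 (rec_fun_nth 0).
Qed.

Lemma cfun_p2 f : cfun f -> cfun (fun e => p2 (f e)).
Proof.
by apply: (cfun_op1 (op := p2));
  first exact: rec_fun_p2 (rec_fun_nth 0).
Qed.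

Lemma cfun_succ f : cfun f -> cfun (fun e => (f e).+1).
Proof.
by apply: (cfun_op1 (op := succn));
  first exact: rec_fun_succ (rec_fun_nth 0).
Qed.

Lemma cfun_pred f : cfun f -> cfun (fun e => (f e).-1).
Proof.
by apply: (cfun_op1 (op := predn));
  first exact: rec_fun_pred (rec_fun_nth 0).
Qed.

Lemma cfun_add f g : cfun f -> cfun g -> cfun (fun e => f e + g e).
Proof.
by apply: (cfun_op2 (op := addn));
  first exact: rec_fun_add (rec_fun_nth 0) (rec_fun_nth 1).
Qed.

Lemma cfun_sub f g : cfun f -> cfun g -> cfun (fun e => f e - g e).
Proof.
by apply: (cfun_op2 (op := subn));
  first exact: rec_fun_sub (rec_fun_nth 0) (rec_fun_nth 1).
Qed.

End Arithmetic.

Section Tests.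
Context {E : Type} `{encoding E}.
Implicit Types (f g : E -> nat) (b c : E -> bool).

Lemma cfun_mul f g : cfun f -> cfun g -> cfun (fun e => f e * g e).
Proof.
move=> Hf Hg.
apply: (@cfun_ext _ _ _ _ (fun e => nat_rect (fun=> nat) 0 (fun _ h => g e + h) (f e))).
  by move=> e; elim: (f e) => //= n ->; rewrite mulSn.
apply: cfun_natrec Hf; first exact: cfun_const.
apply: cfun_add; first by apply: cfun_comp Hg _; apply: cfun_fst cfun_id.
by apply/cfun_snd/cfun_snd/cfun_id.
Qed.

(** A primitive recursion of length [b e]: no round leaves [y e], one round yields [x e]. *)
Lemma cfun_if A `{encoding A} b (x y : E -> A) :
  cfun b -> cfun x -> cfun y -> cfun (fun e => if b e then x e else y e).
Proof.
move=> Hb Hx Hy.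
have Hn : cfun (fun e => nat_of_bool (b e)) by case: Hb => k Hk; exists k.
have HF : cfun (fun p : E * (nat * A) => x p.1) by apply: cfun_comp Hx (cfun_fst cfun_id).
have := cfun_natrec (f := fun e _ _ => x e) Hy HF Hn.
by apply: cfun_ext => e; case: (b e).
Qed.

Lemma cfun_eq0 f : cfun f -> cfun (fun e => f e == 0).
Proof.
apply: (cfun_op1 (op := fun n => n == 0)
  (rec_fun_sub (rec_fun_succ rec_fun_zero) (rec_fun_nth 0))).
by case.
Qed.

Lemma cfun_leq f g : cfun f -> cfun g -> cfun (fun e => f e <= g e).
Proof. by move=> Hf Hg; apply: cfun_eq0; apply: cfun_sub. Qed.

Lemma cfun_and b c : cfun b -> cfun c -> cfun (fun e => b e && c e).
Proof. by move=> Hb Hc; apply: cfun_if Hb Hc (cfun_const _). Qed.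

Lemma cfun_neg b : cfun b -> cfun (fun e => ~~ b e).
Proof. by move=> Hb; apply: cfun_if Hb (cfun_const _) (cfun_const _). Qed.

Lemma cfun_imply b c : cfun b -> cfun c -> cfun (fun e => b e ==> c e).
Proof. by move=> Hb Hc; apply: cfun_if Hb Hc (cfun_const _). Qed.

Lemma cfun_eqn f g : cfun f -> cfun g -> cfun (fun e => f e == g e).
Proof.
move=> Hf Hg; have := cfun_and (cfun_leq Hf Hg) (cfun_leq Hg Hf).
by apply: cfun_ext => e; rewrite eqn_leq.
Qed.

End Tests.

Section Loops.
Context {E : Type} `{encoding E}.

Lemma cfun_iter A `{encoding A} (n : E -> nat) (s : E -> A -> A) (x : E -> A) :
  cfun n -> cfun (fun p : E * A => s p.1 p.2) -> cfun x ->
  cfun (fun e => iter (n e) (s e) (x e)).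
Proof.
move=> Hn Hs Hx.
have Hs' : cfun (fun p : E * (nat * A) => s p.1 p.2.2).
  have := cfun_comp Hs (cfun_pair (cfun_fst cfun_id) (cfun_snd (cfun_snd cfun_id))).
  exact.
have := cfun_natrec (f := fun e _ => s e) Hx Hs' Hn.
by apply: cfun_ext => e; elim: (n e) => //= k ->.
Qed.

Lemma cfun_all (n : E -> nat) (p : E -> nat -> bool) :
  cfun n -> cfun (fun q : E * nat => p q.1 q.2) ->
  cfun (fun e => all (p e) (iota 0 (n e))).
Proof.
move=> Hn Hp.
have Hf : cfun (fun q : E * (nat * bool) => q.2.2 && p q.1 q.2.1).
  apply: cfun_and; first exact: cfun_snd (cfun_snd cfun_id).
  exact: cfun_comp Hp (cfun_pair (cfun_fst cfun_id) (cfun_fst (cfun_snd cfun_id))).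
have := cfun_natrec (f := fun e i h => h && p e i) (cfun_const true) Hf Hn.
apply: cfun_ext => e; elim: (n e) => // k IH.
by rewrite -addn1 iotaD all_cat addn1 /= IH andbT.
Qed.

Lemma cfun_mu (p : E -> nat -> bool) (ex : forall e, exists n, p e n) :
  cfun (fun q : E * nat => p q.1 q.2) -> cfun (fun e => ex_minn (ex e)).
Proof.
(* [Mu] searches for a zero, hence the negation. It also puts the candidate before the parameter,
   and [pair] exchanges them. *)
move=> /cfun_neg [c Hc].
have [pair Hpair] := rec_fun_pr (rec_fun_nth 1) (rec_fun_nth 0).
exists (Mu (Comp c [:: pair])) => e /=; case: ex_minnP => m pm min.
split=> [|z lt_zm].
  by eexists [:: _]; [split; [exact: Hpair|] | have := Hc (e, m); rewrite /= pm].
exists 0; eexists [:: _]; [by split; [exact: Hpair|] | have := Hc (e, z)].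
suff -> : p e z = false by [].
by apply/negP => /min; rewrite leqNgt lt_zm.
Qed.

End Loops.

Lemma cfun_comp2 E A B C `{encoding E} `{encoding A} `{encoding B} `{encoding C}
    (h : A -> B -> C) (f : E -> A) (g : E -> B) :
  cfun (fun p : A * B => h p.1 p.2) -> cfun f -> cfun g ->
  cfun (fun e => h (f e) (g e)).
Proof. by move=> Hh Hf Hg; have := cfun_comp Hh (cfun_pair Hf Hg). Qed.

Lemma cfun_comp3 E A B C D
    `{encoding E} `{encoding A} `{encoding B} `{encoding C} `{encoding D}
    (h : A -> B -> C -> D) (f : E -> A) (g : E -> B) (k : E -> C) :
  cfun (fun p : A * B * C => h p.1.1 p.1.2 p.2) -> cfun f -> cfun g -> cfun k ->
  cfun (fun e => h (f e) (g e) (k e)).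
Proof.
by move=> Hh Hf Hg Hk; have := cfun_comp Hh (cfun_pair (cfun_pair Hf Hg) Hk).
Qed.

Create HintDb cfun.
Ltac cfun_tac := cbv beta zeta; lazymatch goal with
  | |- cfun (fun e => e) => exact: cfun_id
  | |- cfun (fun _ => ?a) => exact: cfun_const
  | |- cfun (fun e => (@?f e, @?g e)) => apply: (@cfun_pair _ _ _ _ _ _ f g); cfun_tac
  | |- cfun (fun e => fst (@?f e)) => apply: (@cfun_fst _ _ _ _ _ _ f); cfun_tac
  | |- cfun (fun e => snd (@?f e)) => apply: (@cfun_snd _ _ _ _ _ _ f); cfun_tac
  | |- cfun (fun e => pr (@?f e) (@?g e)) => apply: (@cfun_pr _ _ f g); cfun_tac
  | |- cfun (fun e => p1 (@?f e)) => apply: (@cfun_p1 _ _ f); cfun_tac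
  | |- cfun (fun e => p2 (@?f e)) => apply: (@cfun_p2 _ _ f); cfun_tac
  | |- cfun (fun e => succn (@?f e)) => apply: (@cfun_succ _ _ f); cfun_tac
  | |- cfun (fun e => predn (@?f e)) => apply: (@cfun_pred _ _ f); cfun_tac
  | |- cfun (fun e => addn (@?f e) (@?g e)) => apply: (@cfun_add _ _ f g); cfun_tac
  | |- cfun (fun e => subn (@?f e) (@?g e)) => apply: (@cfun_sub _ _ f g); cfun_tac
  | |- cfun (fun e => muln (@?f e) (@?g e)) => apply: (@cfun_mul _ _ f g); cfun_tac
  | |- cfun (fun e => leq (@?f e) (@?g e)) => apply: (@cfun_leq _ _ f g); cfun_tac
  | |- cfun (fun e => eq_op (@?f e) (@?g e)) => apply: (@cfun_eqn _ _ f g); cfun_tac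
  | |- cfun (fun e => andb (@?f e) (@?g e)) => apply: (@cfun_and _ _ f g); cfun_tac
  | |- cfun (fun e => implb (@?f e) (@?g e)) => apply: (@cfun_imply _ _ f g); cfun_tac
  | |- cfun (fun e => negb (@?f e)) => apply: (@cfun_neg _ _ f); cfun_tac
  | |- cfun (fun e => match @?b e with true => @?f e | false => @?g e end) =>
      apply: (@cfun_if _ _ _ _ b f g); cfun_tac
  | |- cfun (fun e => iter (@?n e) (@?s e) (@?x e)) =>
      apply: (@cfun_iter _ _ _ _ n s x); cfun_tac
  | |- cfun (fun e => all (@?p e) (iota 0 (@?n e))) =>
      apply: (@cfun_all _ _ n p); cfun_tac
  (* A constant argument can be taken for [@?f e], so all three shapes are tried. *)
  | |- _ => match goal with
    | |- cfun (fun e => ?h (@?f e) (@?g e) (@?k e)) =>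
        apply: (@cfun_comp3 _ _ _ _ _ _ _ _ _ _ h f g k); [solve [auto with cfun]|cfun_tac..]
    | |- cfun (fun e => ?h (@?f e) (@?g e)) =>
        apply: (@cfun_comp2 _ _ _ _ _ _ _ _ h f g); [solve [auto with cfun]|cfun_tac..]
    | |- cfun (fun e => ?h (@?f e)) =>
        apply: (@cfun_comp _ _ _ _ _ _ h f); [solve [auto with cfun]|cfun_tac]
    end
  end.

(** * A universal machine *)

(** The successor keeps [0] for the empty list. Head and tail of [0] are again [0], matching the
    convention that missing arguments read as 0. *)
Definition lcons (x l : nat) : nat := (pr x l).+1.
Definition lhd (l : nat) : nat := p1 l.-1.
Definition ltl (l : nat) : nat := p2 l.-1.
Definition lnth (l i : nat) : nat := lhd (iter i ltl l).

Lemma lhdK x l : lhd (lcons x l) = x.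
Proof. exact: p1K. Qed.

Lemma ltlK x l : ltl (lcons x l) = l.
Proof. exact: p2K. Qed.

Lemma cfun_lcons : cfun (fun p : nat * nat => lcons p.1 p.2).
Proof. rewrite /lcons; cfun_tac. Qed.

Lemma cfun_lhd : cfun lhd.
Proof. rewrite /lhd; cfun_tac. Qed.

Lemma cfun_ltl : cfun ltl.
Proof. rewrite /ltl; cfun_tac. Qed.

#[local] Hint Resolve cfun_lcons cfun_lhd cfun_ltl : cfun.

Lemma cfun_lnth : cfun (fun p : nat * nat => lnth p.1 p.2).
Proof. rewrite /lnth; cfun_tac. Qed.

#[local] Hint Resolve cfun_lnth : cfun.

Fixpoint seq_code (v : seq nat) : nat :=
  if v is x :: v' then lcons x (seq_code v') else 0.

Lemma lhd_seq_code v : lhd (seq_code v) = head 0 v.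
Proof. by case: v => [|x v]; rewrite /= ?lhdK. Qed.

Lemma ltl_seq_code v : ltl (seq_code v) = seq_code (behead v).
Proof. by case: v => [|x v]; rewrite /= ?ltlK. Qed.

Lemma lnth_seq_code v i : lnth (seq_code v) i = nth 0 v i.
Proof.
rewrite -[i in RHS]addn0 -nth_drop nth0 /lnth -lhd_seq_code; congr lhd.
elim: i v => [|i IH] v; first by rewrite drop0.
by rewrite iterSr ltl_seq_code IH -drop1 drop_drop addn1.
Qed.

Fixpoint recf_code (c : recf) : nat :=
  match c with
  | Zero => pr 0 0
  | Succ => pr 1 0
  | Proj i => pr 2 i
  | Comp f gs => pr 3 (pr (recf_code f) (seq_code [seq recf_code g | g <- gs]))
  | Prec f g => pr 4 (pr (recf_code f) (recf_code g))
  | Mu f => pr 5 (recf_code f)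
  end.

(* A state is the last returned value and a stack of frames. [eval_frame c v] evaluates
   [c] on [v]; [args_frame gs v] evaluates the list [gs] on [v], last element first, with
   [arg_frame] and [cons_frame] prepending one value; [call_frame f] evaluates [f] on the
   returned list. The other two are the loops of [Prec] ([j] is the counter and [m] the
   number of remaining rounds) and [Mu]. *)
Definition state (r stack : nat) : nat := pr r stack.
Definition eval_frame (c v : nat) : nat := pr 0 (pr c v).
Definition args_frame (gs v : nat) : nat := pr 1 (pr gs v).
Definition arg_frame (g v : nat) : nat := pr 2 (pr g v).
Definition cons_frame (ys : nat) : nat := pr 3 ys.
Definition call_frame (f : nat) : nat := pr 4 f.
Definition prec_frame (g w j m : nat) : nat := pr 5 (pr (pr g w) (pr j m)).
Definition mu_frame (f v z : nat) : nat := pr 6 (pr (pr f v) z).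

Definition step_eval (r c v K : nat) : nat :=
  if p1 c == 0 then state 0 K
  else if p1 c == 1 then state (lhd v).+1 K
  else if p1 c == 2 then state (lnth v (p2 c)) K
  else if p1 c == 3 then
    state r (lcons (args_frame (p2 (p2 c)) v) (lcons (call_frame (p1 (p2 c))) K))
  else if p1 c == 4 then
    state r (lcons (eval_frame (p1 (p2 c)) (ltl v))
              (lcons (prec_frame (p2 (p2 c)) (ltl v) 0 (lhd v)) K))
  else state r (lcons (eval_frame (p2 c) (lcons 0 v)) (lcons (mu_frame (p2 c) v 0) K)).

Definition step_prec (r g w j m K : nat) : nat :=
  if m == 0 then state r K
  else state r (lcons (eval_frame g (lcons j (lcons r w)))
                 (lcons (prec_frame g w j.+1 m.-1) K)).

Definition step_mu (r f v z K : nat) : nat :=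
  if r == 0 then state z K
  else state r (lcons (eval_frame f (lcons z.+1 v)) (lcons (mu_frame f v z.+1) K)).

Definition step_args (r gs v K : nat) : nat :=
  if gs == 0 then state 0 K
  else state r (lcons (args_frame (ltl gs) v) (lcons (arg_frame (lhd gs) v) K)).

Definition step_frame (r F K : nat) : nat :=
  let x := p2 F in
  if p1 F == 0 then step_eval r (p1 x) (p2 x) K
  else if p1 F == 1 then step_args r (p1 x) (p2 x) K
  else if p1 F == 2 then
    state r (lcons (eval_frame (p1 x) (p2 x)) (lcons (cons_frame r) K))
  else if p1 F == 3 then state (lcons r x) K
  else if p1 F == 4 then state r (lcons (eval_frame x r) K)
  else if p1 F == 5 then
    step_prec r (p1 (p1 x)) (p2 (p1 x)) (p1 (p2 x)) (p2 (p2 x)) K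
  else step_mu r (p1 (p1 x)) (p2 (p1 x)) (p2 x) K.

Definition halted (s : nat) : bool := p2 s == 0.

(** Halted states are fixed, so the result stays readable at every later time. *)
Definition step (s : nat) : nat :=
  if p2 s == 0 then s else step_frame (p1 s) (lhd (p2 s)) (ltl (p2 s)).

Lemma cfun_step : cfun step.
Proof.
rewrite /step /step_frame /step_eval /step_args /step_prec /step_mu
  /eval_frame /args_frame /arg_frame /cons_frame /call_frame /prec_frame /mu_frame
  /state.
cfun_tac.
Qed.

Lemma step_cons r F K : step (state r (lcons F K)) = step_frame r F K.
Proof. by rewrite /step /state p1K p2K lhdK ltlK. Qed.

Definition pairK := (p1K, p2K, lhdK, ltlK).

Definition reaches (s t : nat) : Prop := exists n, iter n step s = t.

Lemma reaches_refl s : reaches s s.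
Proof. by exists 0. Qed.

Lemma reaches_trans t s u : reaches s t -> reaches t u -> reaches s u.
Proof. by move=> [m <-] [n <-]; exists (n + m); rewrite iterD. Qed.

Lemma reaches_step r F K t : reaches (step_frame r F K) t -> reaches (state r (lcons F K)) t.
Proof. by apply: reaches_trans; exists 1; rewrite /= step_cons. Qed.

Ltac machine_step :=
  apply: reaches_step;
  rewrite /step_frame /step_eval /eval_frame /args_frame /arg_frame /cons_frame
    /call_frame /prec_frame /mu_frame !pairK /=.

(** The register [r] and the stack [K] are arbitrary, so that the induction hypotheses apply to
    calls made inside a larger evaluation. *)
Lemma simulation c v y r K :
  reval c v y ->
  reaches (state r (lcons (eval_frame (recf_code c) (seq_code v)) K)) (state y K).
Proof.
elim/recf_nested_ind: c v y r K => [||i|f gs If Ig|f g If Ig|f If] v y r K.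
- by move=> ->; machine_step; exact: reaches_refl.
- by move=> ->; machine_step; rewrite lhd_seq_code nth0; exact: reaches_refl.
- by move=> ->; machine_step; rewrite lnth_seq_code; exact: reaches_refl.
- move=> [ys Hys Hf]; machine_step.
  have Hargs L : reaches
      (state r (lcons (pr 1 (pr (seq_code [seq recf_code g | g <- gs]) (seq_code v))) L))
      (state (seq_code ys) L).
    elim: gs ys Ig Hys L {Hf} => [|g gs IH] [|z ys] //= Ig; last first.
    + move=> [Hg Hgs] L; machine_step; rewrite /step_args /= !pairK.
      apply: reaches_trans; first by apply: IH Hgs _ => i; apply: (Ig i.+1).
      machine_step; apply: reaches_trans; first exact: (Ig 0 isT) Hg.
      by machine_step; exact: reaches_refl.
    + by move=> _ L; machine_step; exact: reaches_refl.
  apply: reaches_trans (Hargs _) _; machine_step.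
  exact: If Hf.
- move=> [s [Hs0 Hs ->]]; machine_step.
  rewrite lhd_seq_code ltl_seq_code; apply: reaches_trans; first exact: If Hs0.
  (* Loop invariant: after [j] rounds the returned value is [s j], with [m] rounds left. *)
  have Hloop m j : j + m = head 0 v -> reaches
      (state (s j) (lcons (prec_frame (recf_code g) (seq_code (behead v)) j m) K))
      (state (s (head 0 v)) K).
    elim: m j => [|m IH] j Ej; machine_step; rewrite /step_prec.
      by rewrite -Ej addn0; exact: reaches_refl.
    apply: reaches_trans.
      by apply: (Ig [:: j, s j & behead v] (s j.+1)); apply: Hs; lia.
    by apply: IH; lia.
  exact: Hloop.
- move=> [Hy Hlt]; machine_step.
  have Hloop m z u : z + m = y -> reaches
      (state u (lcons (eval_frame (recf_code f) (seq_code (z :: v)))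
        (lcons (mu_frame (recf_code f) (seq_code v) z) K)))
      (state y K).
    elim: m z u => [|m IH] z u Ez.
      apply: reaches_trans; first by apply: If; rewrite addn0 in Ez; rewrite Ez; exact: Hy.
      by machine_step; rewrite /step_mu -Ez addn0; exact: reaches_refl.
    have [k Hk] : exists k, reval f (z :: v) k.+1 by apply: Hlt; lia.
    apply: reaches_trans; first exact: If Hk.
    by machine_step; rewrite /step_mu; apply: IH; lia.
  exact: (Hloop y 0).
Qed.

(** * A universal family of decidable sets *)

#[local] Hint Resolve cfun_step : cfun.

Definition run (e i t : nat) : nat :=
  iter t step (state 0 (lcons (eval_frame e (lcons i 0)) 0)).

Lemma cfun_run : cfun (fun p : nat * nat * nat => run p.1.1 p.1.2 p.2).
Proof. rewrite /run /state /eval_frame; cfun_tac. Qed.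

#[local] Hint Resolve cfun_run : cfun.

(** Asking for the first halting time keeps the relation decidable for all [e] and leaves at most
    one [t] per input. *)
Definition halts_at (e i t : nat) : bool :=
  halted (run e i t) && all (fun u => ~~ halted (run e i u)) (iota 0 t).

Lemma cfun_halts_at : cfun (fun p : nat * nat * nat => halts_at p.1.1 p.1.2 p.2).
Proof. rewrite /halts_at /halted; cfun_tac. Qed.

#[local] Hint Resolve cfun_halts_at : cfun.

Lemma halts_at_inj e i t u : halts_at e i t -> halts_at e i u -> t = u.
Proof.
move=> /andP[Ht /allP Ht'] /andP[Hu /allP Hu'].
case: (ltngtP t u) => // lt.
  by have := Hu' t; rewrite mem_iota /= lt Ht => /(_ isT).
by have := Ht' u; rewrite mem_iota /= lt Hu => /(_ isT).
Qed.

Lemma universality H : cfun H ->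
  exists e, forall i, exists t, halts_at e i t /\ p1 (run e i t) = H i.
Proof.
move=> [c Hc]; exists (recf_code c) => i.
have [n Hn] : reaches (state 0 (lcons (eval_frame (recf_code c) (lcons i 0)) 0))
    (state (H i) 0) by exact: (simulation 0 0 (Hc i)).
have ex : exists n, halted (run (recf_code c) i n).
  by exists n; rewrite /run Hn /halted /state p2K.
case: (ex_minnP ex) => t Ht min; exists t; split.
  rewrite /halts_at Ht; apply/allP => u; rewrite mem_iota /= => lt_ut.
  by apply/negP => /min; rewrite leqNgt lt_ut.
have le_tn : t <= n by apply: min; rewrite /run Hn /halted /state p2K.
suff : run (recf_code c) i n = run (recf_code c) i t.
  by move=> <-; rewrite /run Hn /state p1K.
rewrite -(subnK le_tn) /run iterD -/(run _ _ t).
by elim: (n - t) => //= k ->; rewrite /step (eqP Ht) eqxx.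
Qed.

(** Later entries are prepended, so [F i] sits at position [n - i.+1]. *)
Definition table (F : nat -> nat) (n : nat) : nat :=
  nat_rect (fun=> nat) 0 (fun i l => lcons (F i) l) n.

Lemma lnth_table F n i : i < n -> lnth (table F n) (n - i.+1) = F i.
Proof.
elim: n => // n IH; rewrite ltnS leq_eqVlt => /orP[/eqP ->|lt_in].
  by rewrite subnn /lnth /= lhdK.
rewrite subSn // /lnth iterSr; rewrite -[RHS]IH //.
by rewrite [table _ _]/= ltlK.
Qed.

Lemma cfun_table E `{encoding E} (F : E -> nat -> nat) (n : E -> nat) :
  cfun (fun p : E * nat => F p.1 p.2) -> cfun n -> cfun (fun e => table (F e) (n e)).
Proof.
move=> HF Hn; apply: cfun_natrec Hn; first exact: cfun_const.
cfun_tac.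
Qed.

(* The set with index [m = (e, (x, B))]. Its elements are pairs [(i, t)]: for [x <= i]
   the program [e] on input [i] must halt after exactly [t] steps, with a table whose
   entry at [x] is 1; the finitely many [i < x] are decided by the table [B]. *)
Definition uset (m j : nat) : bool :=
  if p1 (p2 m) <= p1 j then
    halts_at (p1 m) (p1 j) (p2 j) &&
    (lnth (p1 (run (p1 m) (p1 j) (p2 j))) (p1 j - p1 (p2 m)) == 1)
  else
    (p2 j == p1 (lnth (p2 (p2 m)) (p1 (p2 m) - (p1 j).+1))) &&
    (p2 (lnth (p2 (p2 m)) (p1 (p2 m) - (p1 j).+1)) == 1).

Lemma cfun_uset : cfun (fun p : nat * nat => uset p.1 p.2).
Proof. rewrite /uset; cfun_tac. Qed.

Lemma cfun_nat_of_bool E `{encoding E} (b : E -> bool) :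
  cfun b -> cfun (fun e => nat_of_bool (b e)).
Proof. by move=> [c Hc]; exists c. Qed.

(** [uset (m x)] is the set of all pairs [(i, T i)] with [G x i]. As the halting time [T i] is the
    same for all [x], two such sets are equal exactly when the rows of [G] are. *)
Lemma uset_universal (G : nat -> nat -> bool) :
  cfun (fun p : nat * nat => G p.1 p.2) ->
  exists2 m : nat -> nat, cfun m &
    forall x y, (forall i, G x i = G y i) <-> (forall j, uset (m x) j = uset (m y) j).
Proof.
move=> HG; pose H i := table (fun x => nat_of_bool (G x i)) i.+1.
have HH : cfun H.
  apply: cfun_table; last exact: cfun_succ cfun_id.
  have := cfun_nat_of_bool (cfun_comp HG (cfun_pair (cfun_snd cfun_id) (cfun_fst cfun_id))).
  exact.
have [e He] := universality HH.
have ex i : exists t, halts_at e i t by have [t [Ht _]] := He i; exists t.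
pose T i := ex_minn (ex i).
have HT : cfun T by apply: cfun_mu; cfun_tac.
have haltsE i t : halts_at e i t = (t == T i).
  rewrite /T; case: ex_minnP => u Hu _; apply/idP/eqP => [Ht|-> //].
  exact: halts_at_inj Ht Hu.
have runE i : p1 (run e i (T i)) = H i.
  by have [t [Ht]] := He i; move: Ht; rewrite haltsE => /eqP ->.
(* The table [H i] has no entry at [x > i], so these bits are stored in the index, along with [T i]
   to give all elements the same shape. *)
pose B x := table (fun i => pr (T i) (nat_of_bool (G x i))) x.
have HB : cfun B.
  apply: cfun_table; last exact: cfun_id.
  by apply: cfun_pr; [cfun_tac | exact: cfun_nat_of_bool HG].
pose m x := pr e (pr x (B x)).
have Hm : cfun m by rewrite /m; cfun_tac.
have usetE x i t : uset (m x) (pr i t) = (t == T i) && G x i.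
  rewrite /uset /m !(p1K, p2K) haltsE; case: leqP => Hxi.
    case: eqP => //= ->; rewrite runE /H.
    have := @lnth_table (fun x => nat_of_bool (G x i)) i.+1 x.
    by rewrite subSS ltnS => -> //; case: (G x i).
  by rewrite lnth_table // p1K p2K; case: (G x i).
exists m => // x y; split=> [E j|E i]; first by rewrite -[j]prK !usetE E.
by have := E (pr i (T i)); rewrite !usetE eqxx.
Qed.

(** * Invariants of [Pi01] equivalence relations *)

Lemma cfun_rel3 T : computable_rel3 T ->
  cfun (fun p : nat * nat * nat => T p.1.1 p.1.2 p.2).
Proof.
move=> [c Hc].
have [a Ha] := rec_fun_p1 (rec_fun_p1 (rec_fun_nth 0)).
have [b Hb] := rec_fun_p2 (rec_fun_p1 (rec_fun_nth 0)).
have [d Hd] := rec_fun_p2 (rec_fun_nth 0).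
exists (Comp c [:: a; b; d]) => -[[x y] z] /=; exists [:: x; y; z]; last exact: Hc.
move: (Ha [:: pr (pr x y) z]) (Hb [:: pr (pr x y) z]) (Hd [:: pr (pr x y) z]).
by rewrite /= !(p1K, p2K).
Qed.

Lemma uniform_bound (P : nat -> nat -> Prop) :
  (forall x, exists b, forall s, b <= s -> P x s) ->
  forall n, exists b, forall x s, x <= n -> b <= s -> P x s.
Proof.
move=> HP; elim=> [|n [b Hb]].
  by have [b Hb] := HP 0; exists b => x s; rewrite leqn0 => /eqP -> /Hb.
have [d Hd] := HP n.+1; exists (maxn b d) => x s.
rewrite geq_max leq_eqVlt => /orP[/eqP ->|lt_xn] /andP[bs ds]; first exact: Hd.
exact: Hb.
Qed.

(** Each step either rests at a fixed point or lowers the value by at least one, so the orbit of [x]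
    is constant after [x] steps. *)
Lemma iter_decreasing (f : nat -> nat) x k :
  (forall y, f y <= y) -> x <= k -> iter k f x = iter x f x.
Proof.
move=> Hf; elim/ltn_ind: x k => x IH [|k]; first by case: x IH.
move=> le_xk; have := Hf x; rewrite leq_eqVlt => /orP[/eqP fx|lt_fx].
  have E n : iter n f x = x by elim: n => //= n ->.
  by rewrite !E.
case: x IH le_xk lt_fx => [|x] IH le_xk lt_fx; first by rewrite ltn0 in lt_fx.
by rewrite !iterSr IH ?[in RHS]IH //; lia.
Qed.

Section Invariant.
Variables (R : nat -> nat -> Prop) (T : nat -> nat -> nat -> bool).
Hypotheses (eqR : Equivalence R) (RT : forall x y, R x y <-> forall n, T x y n).
Hypothesis cT : cfun (fun p : nat * nat * nat => T p.1.1 p.1.2 p.2).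

Definition approx (x y s : nat) : bool := all (fun n => T x y n) (iota 0 s).

Lemma approxP x y s : reflect (forall n, n < s -> T x y n) (approx x y s).
Proof.
apply: (iffP allP) => H n; first by move=> lt; apply: H; rewrite mem_iota.
by rewrite mem_iota => /= /H.
Qed.

Lemma approx_rel x y s : R x y -> approx x y s.
Proof. by move=> /RT H; apply/approxP => n _. Qed.

Lemma approx_le x y s t : s <= t -> approx x y t -> approx x y s.
Proof.
by move=> st /approxP H; apply/approxP => n ns; apply: H; apply: leq_trans st.
Qed.

(** If [R x y] fails, some test [T x y n] fails and every later stage sees it. The case split is
    classical; the bound only ensures that the search for a stage ends. *)
Lemma approx_limit x y : exists b, forall s, b <= s -> (approx x y s <-> R x y).
Proof.
have [Hx|/RT nRxy] := classic (R x y).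
  by exists 0 => s _; split=> // _; apply: approx_rel.
have [[n Tn]|H] := classic (exists n, ~~ T x y n); last first.
  case: nRxy => n; apply/negPn/negP => Tn; apply: H; by exists n.
exists n.+1 => s lt_ns; split=> [/approxP /(_ n lt_ns) Tn'|/RT /(_ n) Tn'].
  by rewrite Tn' in Tn.
by rewrite Tn' in Tn.
Qed.

(** The clause [n <= s] makes the stages unbounded, so that every failing test is eventually taken
    into account. *)
Definition stable (n s : nat) : bool :=
  (n <= s) && all (fun x => all (fun y => all (fun z =>
      [&& approx x x s, approx x y s ==> approx y x s
        & approx x y s && approx y z s ==> approx x z s])
    (iota 0 n.+1)) (iota 0 n.+1)) (iota 0 n.+1).

Lemma stableP n s : reflect (n <= s /\ forall x y z, x <= n -> y <= n -> z <= n ->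
    [/\ approx x x s, approx x y s -> approx y x s
      & approx x y s -> approx y z s -> approx x z s]) (stable n s).
Proof.
apply: (iffP andP) => -[ns H]; split=> //.
  move=> x y z Hx Hy Hz; move: H => /allP /(_ x); rewrite mem_iota add0n ltnS => /(_ Hx).
  move=> /allP /(_ y); rewrite mem_iota add0n ltnS => /(_ Hy).
  move=> /allP /(_ z); rewrite mem_iota add0n ltnS => /(_ Hz) /and3P[H1 /implyP H2 /implyP H3].
  by split=> // H4 H5; apply: H3; rewrite H4.
apply/allP => x; rewrite mem_iota add0n ltnS => Hx.
apply/allP => y; rewrite mem_iota add0n ltnS => Hy.
apply/allP => z; rewrite mem_iota add0n ltnS => Hz.
have [H1 H2 H3] := H x y z Hx Hy Hz; rewrite H1 /=.
by apply/andP; split; apply/implyP => // /andP[]; apply: H3.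
Qed.

Lemma stable_exists n : exists s, stable n s.
Proof.
have [b Hb] : exists b, forall x s, x <= n -> b <= s ->
    forall y, y <= n -> (approx x y s <-> R x y).
  apply: (@uniform_bound (fun x s => forall y, y <= n -> (approx x y s <-> R x y))) => x.
  have [b Hb] := uniform_bound (approx_limit x) n.
  by exists b => s bs y yn; apply: Hb.
exists (maxn n b); apply/stableP; split; first exact: leq_maxl.
have E x y : x <= n -> y <= n -> approx x y (maxn n b) <-> R x y.
  by move=> xn yn; apply: Hb => //; exact: leq_maxr.
move=> x y z xn yn zn; split; first by apply: approx_rel; reflexivity.
  by move=> /E Rxy; apply: approx_rel; symmetry; apply: Rxy.
move=> /E Rxy /E Ryz; apply: approx_rel; transitivity y; [exact: Rxy | exact: Ryz].
Qed.

Definition stage (n : nat) : nat := ex_minn (stable_exists n).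

Lemma stage_stable n : stable n (stage n).
Proof. by rewrite /stage; case: ex_minnP. Qed.

Lemma leq_stage m n : m <= n -> stage m <= stage n.
Proof.
move=> le_mn; rewrite {1}/stage; case: ex_minnP => s _; apply.
have /stableP[H1 H2] := stage_stable n; apply/stableP; split; first exact: leq_trans H1.
by move=> x y z xm ym zm; apply: H2; apply: leq_trans le_mn.
Qed.

Lemma approx_refl n x : x <= n -> approx x x (stage n).
Proof. by move=> xn; have /stableP[_ /(_ x x x xn xn xn)[]] := stage_stable n. Qed.

Lemma approx_sym n x y : x <= n -> y <= n ->
  approx x y (stage n) -> approx y x (stage n).
Proof. by move=> xn yn; have /stableP[_ /(_ x y y xn yn yn)[]] := stage_stable n. Qed.

Lemma approx_trans n x y z : x <= n -> y <= n -> z <= n ->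
  approx x y (stage n) -> approx y z (stage n) -> approx x z (stage n).
Proof. by move=> xn yn zn; have /stableP[_ /(_ x y z xn yn zn)[]] := stage_stable n. Qed.

Lemma rep_exists (p : nat * nat) : exists z, approx z p.2 (stage (maxn p.2 p.1)).
Proof. by exists p.2; apply: approx_refl; exact: leq_maxl. Qed.

(** At the stage of [maxn y n], [approx] is an equivalence on [0 .. y], and this stage is the same
    for all [y <= n]. *)
Definition rep (n y : nat) : nat := ex_minn (rep_exists (n, y)).

Lemma rep_approx n y : approx (rep n y) y (stage (maxn y n)).
Proof. by rewrite /rep; case: ex_minnP. Qed.

Lemma rep_min n y z : approx z y (stage (maxn y n)) -> rep n y <= z.
Proof. by move=> H; rewrite /rep; case: ex_minnP => u _; apply. Qed.

Lemma rep_le n y : rep n y <= y.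
Proof. by apply: rep_min; apply: approx_refl; exact: leq_maxl. Qed.

(* Iterating is needed for [n < x]: the stage at which [x] is compared with smaller
   elements depends on [x]. *)
Definition class_value (n x : nat) : nat := iter x (rep n) x.

Lemma class_value_rep n x : class_value n (rep n x) = class_value n x.
Proof.
rewrite /class_value -(iter_decreasing (rep_le n) (rep_le n x)) -iterSr.
by apply: iter_decreasing => //; exact: rep_le.
Qed.

(** Induction on [maxn x y]. Up to [n], both arguments are compared at one stage; beyond it, the
    larger one descends to a representative no larger than the smaller one. *)
Lemma class_value_eq n m x y : x <= m -> y <= m -> n <= m ->
  approx x y (stage m) -> class_value n x = class_value n y.
Proof.
move: {2}(maxn x y).+1 (ltnSn (maxn x y)) => k.
elim: k m x y => // k IH m x y.
wlog lt_xy : x y / x < y.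
  move=> W Hk xm ym nm Exy; case: (ltngtP x y) => [lt|lt|-> //].
    exact: W.
  by symmetry; apply: W => //; rewrite 1?maxnC //; apply: approx_sym.
rewrite ltnS => Hk xm ym nm Exy.
case: (leqP y n) => [yn|ny].
  have En := approx_le (leq_stage nm) Exy.
  have xn : x <= n by lia.
  suff E : rep n x = rep n y by rewrite -class_value_rep E class_value_rep.
  have [rx ry] := (rep_le n x, rep_le n y).
  have := rep_approx n x; rewrite (maxn_idPr xn) => Ex.
  have := rep_approx n y; rewrite (maxn_idPr yn) => Ey.
  apply/eqP; rewrite eqn_leq; apply/andP; split; apply: rep_min.
    rewrite (maxn_idPr xn); apply: (approx_trans (y := y)) => //; try lia.
    by apply: approx_sym.
  rewrite (maxn_idPr yn); apply: (approx_trans (y := x)) => //; lia.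
(* Here [rep n y <= x < y], and both are related to [y] at [stage y], so the induction hypothesis
   applies to [rep n y] and [x]. *)
have Ey := rep_approx n y; have max_y : maxn y n = y by lia.
have Exy' := approx_le (leq_stage ym) Exy.
have le_rx : rep n y <= x by apply: rep_min; rewrite max_y.
rewrite -(class_value_rep n y); symmetry; apply: (IH y); try lia.
rewrite max_y in Ey; apply: (approx_trans (y := y)) => //; try lia.
by apply: approx_sym => //; lia.
Qed.

Lemma class_value_approx n x : x <= n ->
  approx (class_value n x) x (stage n) && (class_value n x <= x).
Proof.
move=> xn; rewrite /class_value; elim: {1 4}x => [|k /andP[IH le_x]] /=.
  by rewrite approx_refl /=.
have le := rep_le n (iter k (rep n) x).
rewrite (leq_trans le) // andbT; apply: (approx_trans (y := iter k (rep n) x)); try lia.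
  by have := rep_approx n (iter k (rep n) x); rewrite (maxn_idPr _) //; lia.
Qed.

Lemma class_valueP x y : R x y <-> forall n, class_value n x = class_value n y.
Proof.
split=> [Rxy n|H].
  apply: (@class_value_eq n (n + x + y)); try lia.
  exact: approx_rel.
(* With [n > k] the test [T x y k] is among those made at [stage n], where [x] and [y] are both
   related to their common value. *)
apply/RT => k; set n := maxn (maxn x y) k.+1.
have [xn yn] : x <= n /\ y <= n by lia.
have /andP[Ex lex] := class_value_approx xn; have /andP[Ey ley] := class_value_approx yn.
rewrite -H in Ey ley.
have /approxP Exy : approx x y (stage n).
  by apply: (approx_trans (y := class_value n x)) => //; first lia; apply: approx_sym => //; lia.
by apply: Exy; have /stableP[] := stage_stable n; lia.
Qed.

Lemma cfun_approx : cfun (fun p : nat * nat * nat => approx p.1.1 p.1.2 p.2).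
Proof. by rewrite /approx; cfun_tac. Qed.

#[local] Hint Resolve cfun_approx : cfun.

Lemma cfun_stage : cfun stage.
Proof. by apply: cfun_mu; rewrite /stable; cfun_tac. Qed.

#[local] Hint Resolve cfun_stage : cfun.

Lemma cfun_rep : cfun (fun p : nat * nat => rep p.1 p.2).
Proof.
have cmax : cfun (fun p : nat * nat => maxn p.1 p.2) by rewrite /maxn; cfun_tac.
have H : cfun (fun p => ex_minn (rep_exists p)).
  by apply: (cfun_mu (p := fun p z => approx z p.2 (stage (maxn p.2 p.1)))); cfun_tac.
by apply: cfun_ext H; case.
Qed.

#[local] Hint Resolve cfun_rep : cfun.

Lemma cfun_class_value : cfun (fun p : nat * nat => class_value p.1 p.2).
Proof. by rewrite /class_value; cfun_tac. Qed.

End Invariant.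

(** The row of [x] is the graph of [class_value] as a function of [n], which turns equality of
    functions into equality of sets. *)
Lemma Pi01_invariant R : Equivalence R -> Pi01 R ->
  exists2 G : nat -> nat -> bool, cfun (fun p : nat * nat => G p.1 p.2) &
    forall x y, R x y <-> forall i, G x i = G y i.
Proof.
move=> eqR [T /cfun_rel3 cT RT].
have cV := cfun_class_value eqR RT cT.
exists (fun x i => class_value eqR RT (p1 i) x == p2 i); first by cfun_tac.
move=> x y; rewrite (class_valueP eqR RT); split=> [E i|E n]; first by rewrite E.
by have := E (pr n (class_value eqR RT n x)); rewrite !(p1K, p2K) eqxx => /esym/eqP ->.
Qed.

(** * The group *)

#[local] Hint Resolve cfun_uset : cfun.

Lemma cfun_divn d : 0 < d -> cfun (fun n => n %/ d).
Proof.
move=> d_gt0; have ex n : exists q, n < q.+1 * d by exists (n %/ d); exact: ltn_ceil.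
have H : cfun (fun n => ex_minn (ex n)).
  by apply: (cfun_mu (p := fun n q => n < q.+1 * d)); cfun_tac.
apply: cfun_ext H => n; case: ex_minnP => q Hq min; apply/eqP; rewrite eqn_leq.
by rewrite min ?ltn_ceil //= -ltnS ltn_divLR.
Qed.

Lemma cfun_modn d : 0 < d -> cfun (fun n => n %% d).
Proof.
move=> /cfun_divn Hd.
have H : cfun (fun n => n - n %/ d * d) by apply: cfun_sub cfun_id (cfun_mul Hd (cfun_const _)).
by apply: cfun_ext H => n; rewrite {1}(divn_eq n d) addKn.
Qed.

Lemma cfun_half : cfun half.
Proof. by apply: cfun_ext (@cfun_divn 2 isT) => n; rewrite divn2. Qed.

Lemma cfun_odd : cfun odd.
Proof.
have H := cfun_eqn (@cfun_modn 2 isT) (cfun_const 1).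
by apply: cfun_ext H => n; rewrite modn2; case: (odd n).
Qed.

#[local] Hint Resolve cfun_half cfun_odd : cfun.

Lemma rel3_cfun (T : nat -> nat -> nat -> bool) :
  cfun (fun p : nat * nat * nat => T p.1.1 p.1.2 p.2) -> computable_rel3 T.
Proof.
move=> [c Hc]; have [triple Ht] := rec_fun_pr
  (rec_fun_pr (rec_fun_nth 0) (rec_fun_nth 1)) (rec_fun_nth 2).
exists (Comp c [:: triple]) => x y z; eexists [:: _]; first by split; first exact: Ht.
exact: (Hc (x, y, z)).
Qed.

(** Lets the word problem be tested on inverses, which are what reading a code from its lowest digit
    computes. *)
Lemma pinv_eq (p q : permN) : p =1 q <-> pinv p =1 pinv q.
Proof.
split=> E n.
  by rewrite -{1}(pinvK q n) -E pfunK.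
by rewrite -{1}(pfunK q n) -E pinvK.
Qed.

(* The composite of these two involutions moves column [0] through all the even
   columns, so that the shift [h] is a product of two involutions. *)
Definition col_even (c : nat) : nat := if odd c then c.-1 else c.+1.
Definition col_odd (c : nat) : nat :=
  if c == 0 then 0 else if odd c then c.+1 else c.-1.

Definition swap (a b f : nat) : nat := if f == a then b else if f == b then a else f.

Lemma col_evenK : involutive col_even.
Proof. by move=> c; rewrite /col_even; case: (boolP (odd c)) => Hc; case: ifP; lia. Qed.

Lemma col_oddK : involutive col_odd.
Proof.
by case=> [|[|c]] //; rewrite /col_odd /=; case E: (odd c) => /=; rewrite E.
Qed.

Lemma swapK a b : involutive (swap a b).
Proof.
move=> f; rewrite /swap; case: (eqVneq f a) => [->|/negbTE nfa].
  by case: eqVneq; rewrite ?eqxx.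
by case: (eqVneq f b) => [->|/negbTE nfb]; rewrite ?eqxx // nfa nfb.
Qed.

Section Group.
Variable A : nat -> nat -> bool.
Hypothesis cA : cfun (fun p : nat * nat => A p.1 p.2).

(* A point [pr c (pr j f)] is the point [f] of the fibre over [j] in column [c]. *)
Definition move_col (s : nat -> nat) (x : nat) : nat := pr (s (p1 x)) (p2 x).
Definition move_fibre (s : nat -> nat -> nat -> nat) (x : nat) : nat :=
  pr (p1 x) (pr (p1 (p2 x)) (s (p1 x) (p1 (p2 x)) (p2 (p2 x)))).

Definition swap_set (c j f : nat) : nat :=
  if ~~ odd c && A c./2 j then swap 0 1 f else f.
Definition swap_col0 (c j f : nat) : nat := if c == 0 then swap 1 2 f else f.

Definition gen_fun (i x : nat) : nat :=
  if i == 0 then move_col col_even x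
  else if i == 1 then move_col col_odd x
  else if i == 2 then move_fibre swap_set x
  else move_fibre swap_col0 x.

Lemma move_colK s : involutive s -> involutive (move_col s).
Proof. by move=> sK x; rewrite /move_col p1K p2K sK prK. Qed.

Lemma move_fibreK s : (forall c j, involutive (s c j)) -> involutive (move_fibre s).
Proof. by move=> sK x; rewrite /move_fibre !(p1K, p2K) sK !prK. Qed.

Lemma swap_setK c j : involutive (swap_set c j).
Proof. by move=> f; rewrite /swap_set; case: (_ && _) => //; exact: swapK. Qed.

Lemma swap_col0K c j : involutive (swap_col0 c j).
Proof. by move=> f; rewrite /swap_col0; case: (c == 0) => //; exact: swapK. Qed.

Lemma gen_funK i : involutive (gen_fun i).
Proof.
move=> x; rewrite /gen_fun; case: (i == 0); [|case: (i == 1); [|case: (i == 2)]].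
- exact: move_colK col_evenK x.
- exact: move_colK col_oddK x.
- exact: move_fibreK swap_setK x.
- exact: move_fibreK swap_col0K x.
Qed.

Lemma cfun_gen_fun : cfun (fun p : nat * nat => gen_fun p.1 p.2).
Proof.
rewrite /gen_fun /move_col /move_fibre /swap_set /swap_col0 /col_even /col_odd /swap.
cfun_tac.
Qed.

#[local] Hint Resolve cfun_gen_fun : cfun.

(** Every generator is its own inverse, so the sign of a letter has no effect on its action. *)
Definition gen (i : 'I_4) : permN := PermN (gen_funK i) (gen_funK i).

(** * Evaluation of words and the complexity of the word problem *)

Lemma word_eval_cons a w x :
  word_eval gen (a :: w) x = gen_fun a.1 (word_eval gen w x).
Proof. by rewrite /= /letter_eval; case: a.2. Qed.

Lemma pinv_word_eval_cons a w x :
  pinv (word_eval gen (a :: w)) x = pinv (word_eval gen w) (gen_fun a.1 x).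
Proof. by rewrite /= /letter_eval; case: a.2. Qed.

Lemma computable_word_eval w : computable (word_eval gen w).
Proof.
change (cfun (word_eval gen w)); elim: w => [|a w IH]; first exact: cfun_id.
have H : cfun (fun x => gen_fun a.1 (word_eval gen w x)) by cfun_tac.
by apply: cfun_ext H => x; rewrite word_eval_cons.
Qed.

(* The leading letter of a word is the lowest digit of its code, and acts first in
   the inverse permutation. *)
Definition read_letter (p : nat * nat) : nat * nat :=
  if p.1 == 0 then p else (p.1.-1 %/ 8, gen_fun (p.1.-1 %% 8)./2 p.2).

(** [x] rounds suffice, as a word is no longer than its code; once the code is [0], [read_letter]
    idles. *)
Definition code_eval (x n : nat) : nat := (iter x read_letter (x, n)).2.

Lemma cfun_code_eval : cfun (fun p : nat * nat => code_eval p.1 p.2).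
Proof.
pose div8 n := n %/ 8; pose mod8 n := n %% 8.
have H8 : cfun div8 := @cfun_divn 8 isT; have M8 : cfun mod8 := @cfun_modn 8 isT.
have cr : cfun read_letter.
  have : cfun (fun p : nat * nat =>
    if p.1 == 0 then p else (div8 p.1.-1, gen_fun (mod8 p.1.-1)./2 p.2)) by cfun_tac.
  exact.
rewrite /code_eval; cfun_tac.
Qed.

Lemma size_word_code k (w : word k) : size w <= word_code w.
Proof.
elim: w => //= a w IH; rewrite ltnS; apply: leq_trans IH _.
apply: leq_trans (leq_addr _ _); apply: leq_pmulr.
exact: leq_ltn_trans (letter_code_lt a).
Qed.

Lemma code_evalE (w : word 4) n :
  code_eval (word_code w) n = pinv (word_eval gen w) n.
Proof.
(* The number of rounds is generalised to any [K >= size w] for the induction on [w]. *)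
rewrite /code_eval; move: {1 2}(word_code w) (size_word_code w) => K.
elim: w n K => [|a w IH] n K.
  move=> _; suff -> : iter K read_letter (0, n) = (0, n) by [].
  by elim: K => //= K ->.
case: K => [|K] //; rewrite [size _]/= ltnS => {}/IH IH.
rewrite iterSr pinv_word_eval_cons -(IH (gen_fun a.1 n)); congr (iter _ _ _).2.
have lt_a : letter_code a < 8 by exact: letter_code_lt.
rewrite /read_letter /= -[4.*2]/8 divnMDl // divn_small // addn0 modnMDl modn_small //.
by rewrite /letter_code [_ + a.2]addnC half_bit_double.
Qed.

Lemma word_problem_code x y :
  word_problem gen x y <-> forall n, code_eval x n == code_eval y n.
Proof.
split=> [[u [v [<- <- /pinv_eq E]]] n|E]; first by rewrite !code_evalE E.
have [u Eu] := @word_code_surj 4 x isT; have [v Ev] := @word_code_surj 4 y isT.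
exists u, v; split=> //; apply/pinv_eq => n.
by rewrite -!code_evalE Eu Ev; apply/eqP.
Qed.

Lemma word_problem_equiv : Equivalence (word_problem gen).
Proof.
split=> [x|x y|x y z]; rewrite !word_problem_code.
- by move=> n.
- by move=> E n; rewrite eq_sym.
- by move=> E F n; rewrite (eqP (E n)).
Qed.

Lemma word_problem_Pi01 : Pi01 (word_problem gen).
Proof.
have ce := cfun_code_eval.
exists (fun x y n => code_eval x n == code_eval y n); last exact: word_problem_code.
by apply: rel3_cfun; cfun_tac.
Qed.

(** * Words that encode the sets [A m] *)

Definition letter (i : nat) : 'I_4 * bool := (inord i, false).

Definition alternate (a b : 'I_4 * bool) (m : nat) (w : word 4) : word 4 :=
  iter m (fun w => a :: b :: w) w.

(** This spells [h^-m g h^m q h^-m g h^m], where [h] is letter 1 after letter 0, [g] is letter 2 and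
    [q] is letter 3. The rightmost letter acts first. *)
Definition set_word (m : nat) : word 4 :=
  alternate (letter 0) (letter 1) m (letter 2 ::
  alternate (letter 1) (letter 0) m (letter 3 ::
  alternate (letter 0) (letter 1) m (letter 2 ::
  alternate (letter 1) (letter 0) m [::]))).

Lemma word_code_cons (a : 'I_4 * bool) w :
  word_code (a :: w) = (word_code w * 8 + letter_code a).+1.
Proof. by []. Qed.

Lemma word_code_alternate a b m w : word_code (alternate a b m w) =
  iter m (fun n => ((n * 8 + letter_code b).+1 * 8 + letter_code a).+1) (word_code w).
Proof. by elim: m => //= m ->. Qed.

Lemma cfun_set_word : cfun (fun m => word_code (set_word m)).
Proof.
pose cons_code i n := (n * 8 + letter_code (letter i)).+1.
pose alt i j m n := iter m (fun n => cons_code i (cons_code j n)) n.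
pose W m := alt 0 1 m (cons_code 2 (alt 1 0 m (cons_code 3
  (alt 0 1 m (cons_code 2 (alt 1 0 m 0)))))).
have H : cfun W by rewrite /W /alt /cons_code; cfun_tac.
by apply: cfun_ext H => m; rewrite /set_word !(word_code_alternate, word_code_cons).
Qed.

Lemma word_eval_letter i w x : i < 4 ->
  word_eval gen (letter i :: w) x = gen_fun i (word_eval gen w x).
Proof. by move=> lt_i; rewrite word_eval_cons /letter /= inordK. Qed.

Lemma word_eval_alternate i j m w x : i < 4 -> j < 4 ->
  word_eval gen (alternate (letter i) (letter j) m w) x =
  iter m (fun y => gen_fun i (gen_fun j y)) (word_eval gen w x).
Proof.
by move=> lt_i lt_j; elim: m => // m IH; rewrite iterS -IH [alternate _ _ _ _]/=
  !word_eval_letter.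
Qed.

Definition shift_col (m c : nat) : nat := iter m (fun c => col_odd (col_even c)) c.

Lemma shift_col0 m : shift_col m 0 = m.*2.
Proof.
elim: m => //= m IH; rewrite {}/shift_col /= -/(shift_col m 0) IH.
by rewrite /col_even odd_double /col_odd /= odd_double.
Qed.

Lemma shift_points m c d :
  iter m (fun y => gen_fun 1 (gen_fun 0 y)) (pr c d) = pr (shift_col m c) d.
Proof. by elim: m => //= m ->; rewrite /gen_fun /= /move_col !(p1K, p2K). Qed.

Lemma unshift_points m c d :
  iter m (fun y => gen_fun 0 (gen_fun 1 y)) (pr (shift_col m c) d) = pr c d.
Proof.
elim: m => // m IH; rewrite -shift_points iterSr iterS !gen_funK.
by rewrite shift_points IH.
Qed.

Lemma set_wordE m c j f : word_eval gen (set_word m) (pr c (pr j f)) =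
  pr c (pr j (swap_set (shift_col m c) j (swap_col0 c j (swap_set (shift_col m c) j f)))).
Proof.
have fibre c' j' f' : gen_fun 2 (pr c' (pr j' f')) = pr c' (pr j' (swap_set c' j' f')).
  by rewrite /gen_fun /= /move_fibre !(p1K, p2K).
have fibre0 c' j' f' : gen_fun 3 (pr c' (pr j' f')) = pr c' (pr j' (swap_col0 c' j' f')).
  by rewrite /gen_fun /= /move_fibre !(p1K, p2K).
rewrite /set_word !(word_eval_alternate, word_eval_letter) //.
have -> x : word_eval gen [::] x = x by [].
by rewrite !(shift_points, fibre, unshift_points, fibre0).
Qed.

(** Over [j] in column 0 the word swaps 0 and 2 if [A m j] holds, since [(0 1)(1 2)(0 1) = (0 2)],
    and swaps 1 and 2 otherwise. *)
Lemma set_word_eq m n :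
  word_eval gen (set_word m) =1 word_eval gen (set_word n) <->
  forall j, A m j = A n j.
Proof.
split=> E x.
  (* The fibre point 0 tells the two cases apart: it goes to 2 or stays fixed. *)
  have := E (pr 0 (pr x 0)); rewrite !set_wordE.
  move=> /(congr1 p2); rewrite !p2K => /(congr1 p2); rewrite !p2K.
  by rewrite !shift_col0 /swap_set !odd_double !doubleK; case: (A m x); case: (A n x).
rewrite -[x]prK -[p2 x]prK !set_wordE.
(* Off column 0 [q] is trivial, so the two copies of [swap_set] cancel. *)
rewrite /swap_col0; case: eqVneq => [->|_]; last by rewrite !swap_setK.
by rewrite !shift_col0 /swap_set !odd_double !doubleK E.
Qed.

End Group.

Theorem theorem5p1 :
  exists (k : nat) (g : 'I_k -> permN),
    (forall p : permN, generated g p -> computable p) /\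
    Pi01_universal (word_problem g).
Proof.
exists 4, (gen uset); split.
  move=> p [w E]; have := computable_word_eval cfun_uset w.
  by apply: (@cfun_ext nat nat) => n; rewrite E.
split; [exact: word_problem_equiv | exact: word_problem_Pi01 cfun_uset |].
move=> R eqR /(Pi01_invariant eqR) [G cG RG].
have [m cm Gm] := uset_universal cG.
exists (fun x => word_code (set_word (m x))).
  exact: cfun_comp cfun_set_word cm.
move=> x y; rewrite RG Gm -set_word_eq; split=> [E|[u [v [Eu Ev E]]]].
  by exists (set_word (m x)), (set_word (m y)).
(* By injectivity of the coding, the words witnessing the word problem are the chosen ones. *)
by rewrite -(word_code_inj Eu) -(word_code_inj Ev).
Qed.
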